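(* Let $G$ and $G'$ be connected graphs, each with vertex set $[n]$, such that the Laplacian simplices $T_G$ and $T_{G'}$ are reflexive. Let $L$ be the Laplacian of $G$, $L_B = LA$, and for $i,j\in[n-1]$ let $M_{ij}=\det L_B(i,n\mid j)$; define $M'_{ij}$ analogously for $G'$. Suppose that $\kappa_G$ divides $nM_{ij}$ and $\kappa_{G'}$ divides $nM'_{ij}$ for all $i,j\in[n-1]$, where $\kappa_G,\kappa_{G'}$ are the numbers of spanning trees of $G,G'$. Let $H$ be the graph with $V(H)=V(G)\uplus V(G')$ and $E(H)=E(G)\uplus E(G')\uplus\{\{u,u'\}\}$ for some $u\in V(G)$ and $u'\in V(G')$. Then $T_H$ is reflexive.
   Context: For a connected simple graph $G$ on vertex set $[m]=\{1,\dots,m\}$, its Laplacian $L$ is the $m\times m$ matrix with $L_{ii}=\deg(i)$, $L_{ij}=-1$ if $\{i,j\}$ is an edge and $0$ otherwise. Let $A$ be the $m\times(m-1)$ matrix with $a_{ij}=1$ if $i\le j\le m-1$ and $a_{ij}=0$ otherwise, and set $L_B=LA\in\mathbb{Z}^{m\times(m-1)}$ (the matrix of $L$ in the basis $e_1-e_2,\dots,e_{m-1}-e_m$ of $\mathbbm{1}^\perp$). The Laplacian simplex $T_G\subseteq\mathbb{R}^{m-1}$ is the convex hull of the $m$ rows of $L_B$; it is an $(m-1)$-dimensional lattice simplex. For a matrix $M$ and index sets $S,T$, $M(S\mid T)$ denotes the submatrix obtained by deleting the rows indexed by $S$ and the columns indexed by $T$. A full-dimensional lattice polytope $P$ is reflexive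 if it contains the origin in its interior and its dual $P^*=\{x: x\cdot y\le 1\ \forall y\in P\}$ is a lattice polytope. *)

(* Defs.v *)
From HB Require Import structures.
From mathcomp Require Import all_boot all_order all_algebra.
From mathcomp Require Import all_classical all_reals all_analysis.
Set Implicit Arguments.
Unset Strict Implicit.
Unset Printing Implicit Defensive.
Import Order.TTheory GRing.Theory Num.Theory.
Import numFieldNormedType.Exports.
Local Open Scope ring_scope.

Record sgraph (T : finType) := SGraph {
  adj : rel T;
  adj_sym : symmetric adj;
  adj_irrefl : irreflexive adj }.

Definition connected_rel (T : finType) (e : rel T) : Prop :=
  forall x y, connect e x y.

(* In a simple graph a cycle has at least three (pairwise distinct) vertices;
   [ucycle] also accepts shorter sequences, hence the size condition. *)
Definition acyclic_rel (T : finType) (e : rel T) : Prop :=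
  forall s : seq T, (2 < size s)%N -> ~ ucycle e s.

Definition edges (T : finType) (G : sgraph T) : {set {set T}} :=
  [set [set p.1; p.2]%SET | p : T * T & adj G p.1 p.2]%SET.

Definition edge_rel (T : finType) (F : {set {set T}}) : rel T :=
  fun x y => ([set x; y]%SET \in F).

Definition spanning_tree (T : finType) (G : sgraph T) (F : {set {set T}}) :
    Prop :=
  [/\ F \subset edges G, connected_rel (edge_rel F) & acyclic_rel (edge_rel F)].

Definition num_spanning_trees (T : finType) (G : sgraph T) : nat :=
  #|[set F : {set {set T}} | `[< spanning_tree G F >]]%SET|.

Definition deg (T : finType) (G : sgraph T) (x : T) : nat :=
  #|[set y | adj G x y]%SET|.

Definition laplacian (m : nat) (G : sgraph 'I_m) : 'M[int]_m :=
  \matrix_(i, j) (if i == j then (deg G i)%:Z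
                  else if adj G i j then -1 else 0).

(* Rows 1, ..., m are represented by 0, ..., m.-1 in 'I_m and columns
   1, ..., m-1 by 'I_m.-1; shifting both by one preserves i <= j. *)
Definition summation_mx (m : nat) : 'M[int]_(m, m.-1) :=
  \matrix_(i < m, j < m.-1) (if (i <= j)%N then 1 else 0).

Definition laplacianB (m : nat) (G : sgraph 'I_m) : 'M[int]_(m, m.-1) :=
  laplacian G *m summation_mx m.

(* det L_B(i,n | j) for a graph with n.+1 vertices: the last row is removed
   first, so that i : 'I_n still designates row i of L_B. *)
Definition laplacianB_minor (n : nat) (G : sgraph 'I_n.+1) (i j : 'I_n) : int :=
  \det (row' i (col' j (row' ord_max (laplacianB G) : 'M[int]_n))).

Local Open Scope classical_set_scope.

Definition conv_rows (R : realType) (k d : nat) (V : 'M[R]_(k, d)) :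
    set 'rV[R]_d :=
  [set x | exists w : 'rV[R]_k,
     [/\ forall i, 0 <= w 0 i, \sum_i w 0 i = 1 & x = w *m V]].

Definition lattice_polytope (R : realType) (d : nat) (P : set 'rV[R]_d) :
    Prop :=
  exists (k : nat) (V : 'M[int]_(k, d)),
    P = conv_rows (map_mx (fun z : int => z%:~R) V).

Definition dual_set (R : realType) (d : nat) (P : set 'rV[R]_d) :
    set 'rV[R]_d :=
  [set x | forall y, P y -> \sum_i x 0 i * y 0 i <= 1].

(* Full-dimensionality of P is implied by 0 being an interior point of P in
   the ambient space R^d. *)
Definition reflexive_polytope (R : realType) (d : nat) (P : set 'rV[R]_d) :
    Prop :=
  [/\ lattice_polytope P, interior P 0 & lattice_polytope (dual_set P)].

Definition laplacian_simplex (R : realType) (m : nat) (G : sgraph 'I_m) :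
    set 'rV[R]_(m.-1) :=
  conv_rows (map_mx (fun z : int => z%:~R) (laplacianB G)).

Arguments laplacian_simplex R {m} G.

Definition bridge_adj (T T' : finType) (G : sgraph T) (G' : sgraph T')
    (u : T) (u' : T') : rel (T + T')%type :=
  fun a b => match a, b with
    | inl x, inl y => adj G x y
    | inr x, inr y => adj G' x y
    | inl x, inr y => (x == u) && (y == u')
    | inr x, inl y => (y == u) && (x == u')
    end.

Fact bridge_adj_sym (T T' : finType) (G : sgraph T) (G' : sgraph T')
  (u : T) (u' : T') : symmetric (bridge_adj G G' u u').
Proof. by move=> [x|x] [y|y] //=; rewrite adj_sym. Qed.

Fact bridge_adj_irrefl (T T' : finType) (G : sgraph T) (G' : sgraph T')
  (u : T) (u' : T') : irreflexive (bridge_adj G G' u u').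
Proof. by move=> [x|x] /=; rewrite adj_irrefl. Qed.

Definition bridge_graph (T T' : finType) (G : sgraph T) (G' : sgraph T')
    (u : T) (u' : T') : sgraph (T + T')%type :=
  SGraph (bridge_adj_sym G G' u u') (bridge_adj_irrefl G G' u u').

(* [f] numbers the vertices of [G] by 'I_m, turning [G] into [H]. *)
Definition labelling (T : finType) (m : nat) (G : sgraph T) (H : sgraph 'I_m)
    (f : T -> 'I_m) : Prop :=
  bijective f /\ forall x y, adj H (f x) (f y) = adj G x y.

(* Main.v *)
(** Write [v_i] for the rows of [L_B].  They sum to zero, so the vertices of the
dual of [T_G] are the [x_k] with [x_k . v_i = 1] for [i <> k] and
[x_k . v_k = 1 - m].  As [z |-> A z] identifies [Z^(m-1)] with the integer
vectors modulo constants, [T_G] is reflexive if and only if, for every [k], the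
equation [L y = 1 - m e_k] has an integer solution.  For the bridged graph on
[2n] vertices and [k] in [G], one takes on [G'] a solution of
[L' y' = 1 - n e_u'] and on [G] a solution of
[L y = 2 (1 - n e_k) - (1 - n e_u)], shifted by a constant so that the flow
[y_u - y'_u'] through the bridge is [-n]. *)
Require Import Defs.
From HB Require Import structures.
From mathcomp Require Import all_boot all_order all_algebra.
From mathcomp Require Import all_classical all_reals all_analysis.
From mathcomp Require Import ring lra zify.
Set Implicit Arguments.
Unset Strict Implicit.
Unset Printing Implicit Defensive.
Import Order.TTheory GRing.Theory Num.Theory.
Import numFieldNormedType.Exports.
Local Open Scope ring_scope.

(** * Balanced graphs and their behaviour under bridges *)

Section LaplacianOperator.
Variables (T : finType) (G : sgraph T).

Definition lap_op (y : T -> int) (i : T) : int :=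
  \sum_(j | adj G i j) (y i - y j).

(** The integral form of reflexivity. It is stated over any finite type so that it applies to the
    sum type carrying the bridged graph, before its vertices are numbered. *)
Definition balanced : Prop :=
  forall k, exists y : T -> int,
    forall i, lap_op y i = 1 - (i == k)%:Z * #|T|%:Z.

Lemma lap_op_lin (a b : int) (y z : T -> int) i :
  lap_op (fun x => a * y x + b * z x) i = a * lap_op y i + b * lap_op z i.
Proof.
rewrite /lap_op !mulr_sumr -big_split /=; apply: eq_bigr => j _; ring.
Qed.

Lemma lap_op_shift (c : int) (y : T -> int) i :
  lap_op (fun x => y x + c) i = lap_op y i.
Proof. by apply: eq_bigr => j _; ring. Qed.

End LaplacianOperator.

Lemma balanced_labelling (T : finType) m (G : sgraph T) (H : sgraph 'I_m) f :
  labelling G H f -> balanced G -> balanced H.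
Proof.
move=> [bf Hf] bG k; case: (bf) => g fK gK.
have [y Hy] := bG (g k); exists (y \o g) => i.
rewrite -(bij_eq_card bf) -(can_eq gK) -Hy /lap_op.
rewrite (reindex f) /=; last exact: onW_bij.
by apply: eq_big => [j|j _]; rewrite ?fK // -{1}(gK i) Hf.
Qed.

Lemma lap_op_bridge_l (T T' : finType) (G : sgraph T) (G' : sgraph T') u u'
    (y : T + T' -> int) i :
  lap_op (bridge_graph G G' u u') y (inl i) =
  lap_op G (y \o inl) i + (i == u)%:Z * (y (inl u) - y (inr u')).
Proof.
rewrite /lap_op big_sumType /=; congr (_ + _).
case: eqP => [->|_] /=; last by rewrite big_pred0 ?mul0r.
by rewrite big_pred1_eq mul1r.
Qed.

Lemma lap_op_bridge_r (T T' : finType) (G : sgraph T) (G' : sgraph T') u u'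
    (y : T + T' -> int) i :
  lap_op (bridge_graph G G' u u') y (inr i) =
  lap_op G' (y \o inr) i + (i == u')%:Z * (y (inr u') - y (inl u)).
Proof.
rewrite /lap_op big_sumType /= addrC; congr (_ + _).
case: eqP => [->|_] /=; last by rewrite big_pred0 ?mul0r // => j; rewrite andbF.
by under eq_bigl do rewrite andbT; rewrite big_pred1_eq mul1r.
Qed.

Lemma balanced_bridge (T T' : finType) (G : sgraph T) (G' : sgraph T') u u' :
  #|T| = #|T'| -> balanced G -> balanced G' ->
  balanced (bridge_graph G G' u u').
Proof.
move=> eqT bG bG'.
have [yu Hu] := bG u; have [yu' Hu'] := bG' u'.
have cE : #|{: T + T'}|%:Z = 2%:Z * #|T'|%:Z.
  by rewrite card_sum eqT -PoszM mul2n addnn.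
case=> k.
  have [yk Hk] := bG k.
  (* The flow [-#|T'|] cancels the surplus of [y] at [u] and the deficit of [yu'] at [u']. *)
  pose y x := 2 * yk x + (-1) * yu x; pose c := yu' u' - y u - #|T'|%:Z.
  exists (fun x => match x with inl x => y x + c | inr x => yu' x end) => -[] i.
    rewrite lap_op_bridge_l /= /comp lap_op_shift lap_op_lin Hk Hu cE eqT /c.
    by rewrite (inj_eq (@inl_inj _ _)); ring.
  by rewrite lap_op_bridge_r /= /comp Hu' cE /c; case: eqP => _ /=; ring.
have [yk Hk] := bG' k.
pose y x := 2 * yk x + (-1) * yu' x; pose c := yu u - y u' - #|T'|%:Z.
exists (fun x => match x with inr x => y x + c | inl x => yu x end) => -[] i.
  by rewrite lap_op_bridge_l /= /comp Hu cE eqT /c; case: eqP => _ /=; ring.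
rewrite lap_op_bridge_r /= /comp lap_op_shift lap_op_lin Hk Hu' cE /c.
by rewrite (inj_eq (@inr_inj _ _)); ring.
Qed.

(** * From functions on vertices to matrices *)

Lemma laplacian_mulE m p (G : sgraph 'I_m) (Y : 'M[int]_(m, p)) i k :
  (laplacian G *m Y) i k = lap_op G (Y^~ k) i.
Proof.
rewrite mxE (bigD1 i) //= mxE eqxx /lap_op sumrB sumr_const -mulr_natl.
have -> : #|adj G i| = deg G i by rewrite /deg cardsE.
rewrite natz; congr (_ + _).
rewrite -sumrN [LHS]big_mkcond [RHS]big_mkcond /=.
apply: eq_bigr => j _; rewrite mxE [j == i]eq_sym; case: eqP => [<-|_] /=.
  by rewrite adj_irrefl.
by case: ifP; rewrite ?mulN1r ?mul0r.
Qed.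

(** [L] is symmetric and kills constants. *)
Lemma laplacianB_colsum m (G : sgraph 'I_m) :
  const_mx 1 *m laplacianB G = 0 :> 'rV_(m.-1).
Proof.
rewrite /laplacianB mulmxA.
have -> : const_mx 1 *m laplacian G = 0 :> 'rV_m; last by rewrite mul0mx.
rewrite -[LHS]trmxK trmx_mul trmx_const.
have -> : (laplacian G)^T = laplacian G.
  by apply/matrixP => i j; rewrite !mxE eq_sym adj_sym; case: eqP => // ->.
apply/matrixP => i j; rewrite mxE laplacian_mulE mxE /lap_op big1 // => k _.
by rewrite !mxE subrr.
Qed.

Lemma laplacianB_real_colsum (R : realType) m (G : sgraph 'I_m) :
  const_mx 1 *m map_mx (fun z : int => z%:~R) (laplacianB G) = 0
    :> 'rV[R]_(m.-1).
Proof.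
have := congr1 (map_mx (intr : int -> R)) (laplacianB_colsum G).
by rewrite map_mxM map_const_mx map_mx0.
Qed.

(** Telescoping. Consecutive differences thus invert [A] up to a constant in each column, which [L]
    does not see. *)
Lemma summation_mxE n p (Y : 'M[int]_(n.+1, p)) i k :
  (summation_mx n.+1 *m
     \matrix_(j, k) (Y (widen_ord (leqnSn n) j) k - Y (lift ord0 j) k)) i k
  = Y i k - Y ord_max k.
Proof.
rewrite mxE /=.
pose g a := Y (inord a) k.
transitivity (\sum_(j < n | (i <= j)%N) (g j - g j.+1)).
  rewrite [RHS]big_mkcond /=; apply: eq_bigr => j _; rewrite !mxE.
  case: ifP => _; rewrite ?mul0r // mul1r /g; congr (Y _ _ - Y _ _);
    by apply/val_inj; rewrite /= inordK ?ltnS // ltnW.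
rewrite -(big_geq_mkord _ _ predT (fun j => g j - g j.+1)).
under eq_bigr do rewrite -opprB.
rewrite sumrN telescope_sumr; last by rewrite -ltnS.
rewrite opprB /g inord_val.
by congr (_ - Y _ _); apply/val_inj; rewrite /= inordK.
Qed.

Local Open Scope classical_set_scope.

(** * Duality for a simplex with vertices the rows of [V] and facet normals the columns of [X] *)

Section SimplexDuality.
Variables (R : realType) (n : nat).
Variables (V : 'M[R]_(n.+1, n)) (X : 'M[R]_(n, n.+1)).
Hypothesis V0 : const_mx 1 *m V = 0 :> 'rV_n.
Hypothesis VX : V *m X = const_mx 1 - n.+1%:R%:M.

(** The scalar matrix [n.+1%:R%:M] has rank [n.+1] and differs from [- (V *m X)] by the all-ones
    matrix, of rank at most one; hence [V *m X] has rank at least [n]. *)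
Lemma simplex_row_full : row_full V.
Proof.
rewrite /row_full eqn_leq rank_leq_col /=.
apply: leq_trans (mxrankM_maxl V X); rewrite VX.
have := mxrank_add (const_mx 1 : 'M[R]_n.+1) (n.+1%:R%:M - const_mx 1).
rewrite addrC subrK -opprB mxrank_opp -scalemx1 mxrank_scale_nz ?pnatr_eq0 //.
rewrite mxrank1 scalemx1.
have -> : const_mx 1 = (const_mx 1 : 'cV[R]_n.+1) *m (const_mx 1 : 'rV[R]_n.+1).
  by apply/matrixP => i j; rewrite !mxE big_ord1 !mxE mulr1.
move=> /leq_trans/(_ (leq_add (mulmx_max_rank _ _) (leqnn _))).
by rewrite add1n ltnS.
Qed.

Lemma simplex_XV : X *m V = - n.+1%:R%:M.
Proof.
apply: (row_full_inj simplex_row_full).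
rewrite mulmxA VX mulmxBl mulmxN mul_scalar_mx mul_mx_scalar.
have -> : const_mx 1 *m V = 0 :> 'M[R]_(n.+1, n); last by rewrite sub0r.
apply/row_matrixP => i; rewrite row_mul row0 -[RHS]V0; congr (_ *m _).
by apply/rowP => j; rewrite !mxE.
Qed.

Lemma simplex_X0 : X *m const_mx 1 = 0 :> 'cV_n.
Proof.
apply: (row_full_inj simplex_row_full).
rewrite mulmxA VX mulmx0 mulmxBl mul_scalar_mx.
apply/matrixP => i j; rewrite !mxE mulr1.
under eq_bigr do rewrite !mxE mulr1.
by rewrite sumr_const card_ord subrr.
Qed.

(** If the weights [w] sum to 1, then [w *m V *m X] is [1 - n.+1 w]. So the barycentric coordinates
    of [x] are the entries of [1 - x *m X] divided by [n.+1], and the inequalities express their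
    nonnegativity. *)
Lemma conv_rows_simplexP (x : 'rV[R]_n) :
  conv_rows V x <-> forall k, (x *m X) 0 k <= 1.
Proof.
have m0 : (n.+1%:R : R) != 0 by rewrite pnatr_eq0.
split=> [[w [w0 w1 ->]] k|xX].
  rewrite -mulmxA VX mulmxBr mul_mx_scalar !mxE.
  under eq_bigr do rewrite mxE mulr1.
  by rewrite w1 gerBl mulr_ge0.
exists (n.+1%:R^-1 *: (const_mx 1 - x *m X)); split.
- move=> i; rewrite !mxE mulr_ge0 ?invr_ge0 // subr_ge0.
  by have := xX i; rewrite mxE.
- transitivity ((n.+1%:R^-1 *: (const_mx 1 - x *m X) *m (const_mx 1 : 'cV_n.+1))
      0 0).
    by rewrite mxE; under [RHS]eq_bigr do rewrite [const_mx 1 _ _]mxE mulr1.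
  rewrite -scalemxAl mulmxBl -mulmxA simplex_X0 mulmx0 subr0 !mxE.
  under eq_bigr do rewrite !mxE mulr1.
  by rewrite sumr_const card_ord mulVf.
- rewrite -scalemxAl mulmxBl V0 -mulmxA simplex_XV sub0r mulmxN opprK.
  by rewrite mul_mx_scalar scalerA mulVf // scale1r.
Qed.

Lemma interior_conv_rows_simplex : interior (conv_rows V) 0.
Proof.
rewrite /interior /=; apply/nbhs_ballP.
(* [S] dominates the absolute sum of each column of [X]; the summand 1 keeps it positive. *)
pose S := 1 + \sum_i \sum_j `|X i j|.
have S0 : 0 < S.
  by rewrite ltr_wpDr // sumr_ge0 // => i _; rewrite sumr_ge0.
exists S^-1 => /=; first by rewrite invr_gt0.
move=> x xS; apply/conv_rows_simplexP => k; rewrite mxE.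
have xle i : `|x 0 i| <= S^-1.
  by have [_ /(_ 0 i)] := xS; rewrite /ball /= mxE sub0r normrN => /ltW.
apply: (@le_trans _ _ (\sum_i S^-1 * \sum_j `|X i j|)).
  apply: ler_sum => i _; apply: le_trans (ler_norm _) _; rewrite normrM.
  apply: ler_pM => //.
  by rewrite (bigD1 k) //= lerDl sumr_ge0.
by rewrite -mulr_sumr ler_pdivrMl // mulr1 lerDr.
Qed.

End SimplexDuality.

Lemma conv_rows_row (R : realType) k d (V : 'M[R]_(k, d)) i :
  conv_rows V (row i V).
Proof.
exists (delta_mx 0 i); split; last by rewrite rowE.
  by move=> j; rewrite mxE; case: (_ && _).
rewrite (bigD1 i) //= mxE !eqxx big1 ?addr0 // => j /negPf ji.
by rewrite mxE ji andbF.
Qed.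

Lemma dual_conv_rowsP (R : realType) k d (V : 'M[R]_(k, d)) (x : 'rV[R]_d) :
  dual_set (conv_rows V) x <-> forall i, (x *m V^T) 0 i <= 1.
Proof.
split=> [dx i|xV y [w [w0 w1 ->]]].
  rewrite mxE; have := dx _ (conv_rows_row V i).
  by congr (_ <= _); apply: eq_bigr => j _; rewrite !mxE.
have -> : \sum_i x 0 i * (w *m V) 0 i = \sum_i w 0 i * (x *m V^T) 0 i.
  transitivity ((x *m (w *m V)^T) 0 0).
    by rewrite mxE; apply: eq_bigr => i _; rewrite [(_^T) _ _]mxE.
  rewrite trmx_mul mulmxA mxE; apply: eq_bigr => i _.
  by rewrite [(w^T) _ _]mxE mulrC.
rewrite -[leRHS]w1; apply: ler_sum => i _.
by rewrite -[leRHS]mulr1 ler_wpM2l.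
Qed.

(** The pair [X^T], [V^T] satisfies the same two hypotheses as [V], [X], so the facet description
    applies to the hull of the rows of [X^T]. *)
Lemma dual_simplex (R : realType) n (V : 'M[R]_(n.+1, n)) (X : 'M[R]_(n, n.+1)) :
  const_mx 1 *m V = 0 :> 'rV_n -> V *m X = const_mx 1 - n.+1%:R%:M ->
  dual_set (conv_rows V) = conv_rows X^T.
Proof.
move=> V0 VX; apply/predeqP => x; rewrite dual_conv_rowsP.
apply: iff_sym; apply: conv_rows_simplexP.
  by apply: trmx_inj; rewrite trmx_mul trmxK trmx_const trmx0 (simplex_X0 VX).
by rewrite -trmx_mul VX linearB /= trmx_const tr_scalar_mx.
Qed.

(** * Reflexivity is equivalent to balancedness *)

Lemma balanced_reflexive (R : realType) n (G : sgraph 'I_n.+1) :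
  balanced G -> reflexive_polytope (laplacian_simplex R G).
Proof.
move=> bG.
have {bG} [y Hy] : exists y : 'I_n.+1 -> 'I_n.+1 -> int, forall k i,
    lap_op G (y k) i = 1 - (i == k)%:Z * n.+1%:Z.
  have [y Hy] := choice bG; exists y => k i.
  by rewrite Hy card_ord.
pose Y := \matrix_(i, k) y k i.
(* [A *m X] equals [Y] up to a constant in each column, so [L_B *m X] equals [L *m Y]. *)
pose X : 'M[int]_(n, n.+1) :=
  \matrix_(j, k) (Y (widen_ord (leqnSn n) j) k - Y (lift ord0 j) k).
have BX : laplacianB G *m X = const_mx 1 - n.+1%:R%:M.
  apply/matrixP => i k; rewrite -mulmxA laplacian_mulE.
  transitivity (lap_op G (y k) i).
    by apply: eq_bigr => j _; rewrite !summation_mxE !mxE; ring.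
  by rewrite Hy !mxE natz; case: eqP => _; rewrite ?mul1r ?mul0r.
pose V := map_mx (fun z : int => z%:~R : R) (laplacianB G).
pose XR := map_mx (fun z : int => z%:~R : R) X.
have V0 : const_mx 1 *m V = 0 :> 'rV_n := laplacianB_real_colsum R G.
have VX : V *m XR = const_mx 1 - n.+1%:R%:M.
  have := congr1 (map_mx (intr : int -> R)) BX.
  by rewrite map_mxM map_mxB map_const_mx map_scalar_mx /= rmorph_nat.
split.
- by exists n.+1, (laplacianB G).
- exact: interior_conv_rows_simplex V0 VX.
- by exists n.+1, X^T; rewrite (dual_simplex V0 VX) map_trmx.
Qed.

(** Small multiples of the unit vectors lie in the hull, hence in the row space. *)
Lemma interior_conv_rows_full (R : realType) k d (V : 'M[R]_(k, d)) :
  interior (conv_rows V) 0 -> row_full V.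
Proof.
rewrite /interior /= => /nbhs_ballP [e /= e0 eV].
rewrite -sub1mx; apply/row_subP => i; rewrite row1.
have /eV [w [_ _ wE]] : ball 0 e ((e / 2) *: delta_mx 0 i : 'rV[R]_d).
  split=> // a b; rewrite /ball /= !mxE sub0r normrN.
  case: (_ && _); last by rewrite mulr0 normr0.
  by rewrite mulr1 gtr0_norm ?divr_gt0 // ltr_pdivrMr //; lra.
have -> : delta_mx 0 i = (e / 2)^-1 *: (w *m V).
  by rewrite -wE scalerA mulVf ?scale1r // gt_eqF // divr_gt0.
by rewrite scalemx_sub // submxMl.
Qed.

Lemma reflexive_balanced (R : realType) n (G : sgraph 'I_n.+1) :
  reflexive_polytope (laplacian_simplex R G) -> balanced G.
Proof.
move=> [_ /interior_conv_rows_full rV [p [W dW]]] k.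
set V := map_mx _ _ in rV.
have V0 : const_mx 1 *m V = 0 :> 'rV_n := laplacianB_real_colsum R G.
pose c : 'rV[R]_n.+1 := const_mx 1 - n.+1%:R *: delta_mx 0 k.
(* The columns of [V] span the vectors of coordinate sum zero, by comparing dimensions, and [c] is
   such a vector. The resulting [x] is the dual vertex opposite to [k]. *)
have /submxP[x xE] : (c <= V^T)%MS.
  have sV : (V^T <= kermx (const_mx 1 : 'cV[R]_n.+1))%MS.
    by apply/sub_kermxP/trmx_inj; rewrite trmx_mul trmxK trmx_const trmx0.
  have /submx_trans-> // : (c <= kermx (const_mx 1 : 'cV[R]_n.+1))%MS.
    apply/sub_kermxP/matrixP => i j; rewrite !mxE.
    rewrite (eq_bigr (fun a => 1 - n.+1%:R * (a == k)%:R)); last first.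
      by move=> a _; rewrite !mxE ord1 eqxx mulr1.
    rewrite sumrB sumr_const card_ord -mulr_sumr (bigD1 k) //= eqxx big1.
      by rewrite addr0 mulr1 subrr.
    by move=> a /negPf->.
  rewrite -(mxrank_leqif_sup sV) mxrank_tr mxrank_ker (eqP rV).
  rewrite eqn_leq; apply/andP; split; last first.
    rewrite leq_subLR -add1n leq_add2r lt0n mxrank_eq0.
    by apply/eqP => /matrixP/(_ 0 0)/eqP; rewrite !mxE oner_eq0.
  by have := mxrankS sV; rewrite mxrank_tr mxrank_ker (eqP rV).
have dualP z := dual_conv_rowsP V z.
have dW' : dual_set (conv_rows V) = conv_rows (map_mx (fun z : int => z%:~R) W).
  by rewrite -dW.
have [w [w0 w1 wE]] : conv_rows (map_mx (fun z : int => z%:~R) W) x.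
  by rewrite -dW'; apply/dualP => i; rewrite -xE !mxE gerBl mulr_ge0.
(* Any vertex [W_j] of the dual with positive weight in [x] satisfies the same
   tight inequalities as [x], and it is integral. *)
have [j wj] : exists j, w 0 j > 0.
  apply/not_existsP => wn; have := oner_neq0 R; rewrite -w1 big1 ?eqxx // => j _.
  by apply/eqP; rewrite eq_le w0 andbT leNgt; apply/negP.
pose WV := map_mx (intr : int -> R) (W *m (laplacianB G)^T).
have WV_E : WV = map_mx (fun z : int => z%:~R) W *m V^T.
  by rewrite /WV map_mxM /= map_trmx.
have WVle a i : WV a i <= 1.
  have : dual_set (conv_rows V) (row a (map_mx (fun z : int => z%:~R) W)).
    by rewrite dW'; apply: conv_rows_row.
  by move=> /dualP/(_ i); rewrite -row_mul mxE WV_E.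
have cE i : \sum_a w 0 a * WV a i = c 0 i by rewrite xE wE -mulmxA -WV_E mxE.
have WV1 i : i != k -> WV j i = 1.
  move=> ik; have : \sum_a w 0 a * (1 - WV a i) = 0.
    rewrite (eq_bigr (fun a => w 0 a - w 0 a * WV a i)) => [|a _]; last first.
      by rewrite mulrBr mulr1.
    by rewrite sumrB w1 cE !mxE (negPf ik) andbF mulr0 subr0 subrr.
  move=> /eqP; rewrite psumr_eq0 => [/allP/(_ j)|a _]; last first.
    by rewrite mulr_ge0 // subr_ge0.
  rewrite mem_index_enum => /(_ isT); rewrite mulf_eq0 gt_eqF //= subr_eq0.
  by move=> /eqP.
have BW1 i : i != k -> (laplacianB G *m W^T) i j = 1.
  move=> /WV1; rewrite mxE -[W *m _]trmxK trmx_mul trmxK => /eqP.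
  by rewrite -[1%R]/(1%:~R) eqr_int [_^T _ _]mxE => /eqP.
(* Since the other [n] entries are 1, the zero sum forces entry [k] to be [-n], that is,
   [1 - n.+1]. *)
have BWs : \sum_i (laplacianB G *m W^T) i j = 0.
  have := laplacianB_colsum G => /(congr1 (mulmx^~ W^T)) /matrixP /(_ 0 j).
  rewrite mul0mx -mulmxA mxE [RHS]mxE => E; rewrite -[RHS]E.
  apply: eq_bigr => i _.
  by rewrite [const_mx _ _ _]mxE mul1r.
exists (fun i => (summation_mx n.+1 *m W^T) i j) => i.
rewrite -laplacian_mulE mulmxA -/(laplacianB G) card_ord.
case: eqP => [->|/eqP ik]; last by rewrite BW1 // mul0r subr0.
move: BWs; rewrite (bigD1 k) //= (eq_bigr (fun=> 1)) => [|a ak]; last exact: BW1.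
rewrite sumr_const cardC1 card_ord natz => /eqP.
rewrite addr_eq0 => /eqP->; rewrite mul1r; lia.
Qed.

Theorem theorem3p14 (R : realType) (n : nat) (G G' : sgraph 'I_n.+1)
  (conG : connected_rel (adj G)) (conG' : connected_rel (adj G'))
  (reflG : reflexive_polytope (laplacian_simplex R G))
  (reflG' : reflexive_polytope (laplacian_simplex R G'))
  (dvdG : forall i j : 'I_n,
     ((num_spanning_trees G)%:Z %| n.+1%:Z * laplacianB_minor G i j)%Z)
  (dvdG' : forall i j : 'I_n,
     ((num_spanning_trees G')%:Z %| n.+1%:Z * laplacianB_minor G' i j)%Z)
  (u u' : 'I_n.+1)
  (H : sgraph 'I_(n.+1 + n.+1)) (f : 'I_n.+1 + 'I_n.+1 -> 'I_(n.+1 + n.+1))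
  (Hf : labelling (bridge_graph G G' u u') H f) :
  reflexive_polytope (laplacian_simplex R H).
Proof.
(* [n.+1 + n.+1] is convertible to [(n + n.+1).+1]. *)
apply: (@balanced_reflexive R (n + n.+1)).
apply: balanced_labelling Hf _; apply: balanced_bridge => //.
  exact: reflexive_balanced reflG.
exact: reflexive_balanced reflG'.
Qed.
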